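(* Let $\tau=\tau^1\mbox{-}\tau^2\mbox{-}\cdots\mbox{-}\tau^s$ be a multi-pattern, where each $\tau^i$ is a non-empty generalized pattern with no hyphens. Then for $k\ge1$, $$A_\tau(x;k)=\sum_{j=1}^s A_{\tau^j}(x;k)\prod_{i=1}^{j-1}\bigl((kx-1)A_{\tau^i}(x;k)+1\bigr).$$
   Context: $[k]^n$ = words of length $n$ over $\{1,\dots,k\}$. A generalized pattern with no hyphens is a word over $[m]$ using every letter of $[m]$; a word contains it if some factor of consecutive letters is order-isomorphic to it (relations $<,=,>$ preserved between all pairs of positions). A multi-pattern $\tau^1\mbox{-}\cdots\mbox{-}\tau^s$ is the concatenation of the blocks with hyphens between them, where letters of different blocks are incomparable; a word $\sigma$ contains it if $\sigma$ has occurrences of $\tau^1,\dots,\tau^s$ in this left-to-right order, pairwise non-overlapping; otherwise $\sigma$ avoids it. For any such pattern $\pi$, $A_\pi(x;k)=\sum_{n\ge0}a_\pi(n;k)x^n$ with $a_\pi(n;k)$ the number of words in $[k]^n$ avoiding $\pi$ ($a_\pi(0;k)=1$). *)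

(* Defs.v *)
From HB Require Import structures.
From mathcomp Require Import all_boot all_order all_algebra.
From mathcomp Require Import boolp.
Set Implicit Arguments.
Unset Strict Implicit.
Unset Printing Implicit Defensive.
Import GRing.Theory.
Local Open Scope ring_scope.

(* Formal power series in one variable over R.  A record rather than an alias
   of [nat -> R], since function types may carry pointwise operations. *)
Record fps (R : comNzRingType) := Fps { fps_coef : nat -> R }.

Lemma fpsP (R : comNzRingType) (f g : fps R) :
  fps_coef f =1 fps_coef g <-> f = g.
Proof.
split=> [|-> //]; case: f g => [f] [g] /= fg.
by congr Fps; apply: funext.
Qed.

HB.instance Definition _ (R : comNzRingType) := gen_eqMixin (fps R).
HB.instance Definition _ (R : comNzRingType) := gen_choiceMixin (fps R).

Definition fps_zero (R : comNzRingType) : fps R := Fps (fun=> 0).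
Definition fps_opp (R : comNzRingType) (f : fps R) : fps R :=
  Fps (fun n => - fps_coef f n).
Definition fps_add (R : comNzRingType) (f g : fps R) : fps R :=
  Fps (fun n => fps_coef f n + fps_coef g n).
Definition fps_one (R : comNzRingType) : fps R := Fps (fun n => (n == 0%N)%:R).
Definition fps_mul (R : comNzRingType) (f g : fps R) : fps R :=
  Fps (fun n => \sum_(i < n.+1) fps_coef f i * fps_coef g (n - i)).

Lemma fps_addA (R : comNzRingType) : associative (@fps_add R).
Proof. by move=> f g h; apply/fpsP => n /=; rewrite addrA. Qed.
Lemma fps_addC (R : comNzRingType) : commutative (@fps_add R).
Proof. by move=> f g; apply/fpsP => n /=; rewrite addrC. Qed.
Lemma fps_add0 (R : comNzRingType) : left_id (fps_zero R) (@fps_add R).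
Proof. by move=> f; apply/fpsP => n /=; rewrite add0r. Qed.
Lemma fps_addN (R : comNzRingType) :
  left_inverse (fps_zero R) (@fps_opp R) (@fps_add R).
Proof. by move=> f; apply/fpsP => n /=; rewrite addNr. Qed.

HB.instance Definition _ (R : comNzRingType) :=
  GRing.isZmodule.Build (fps R)
    (@fps_addA R) (@fps_addC R) (@fps_add0 R) (@fps_addN R).

Definition fps_trunc (R : comNzRingType) (N : nat) (f : fps R) : {poly R} :=
  \poly_(i < N) fps_coef f i.

Lemma fps_coef_mul_trunc (R : comNzRingType) (f g : fps R) (n N : nat) :
  (n < N)%N ->
  fps_coef (fps_mul f g) n = (fps_trunc N f * fps_trunc N g)`_n.
Proof.
move=> nN; rewrite coefM /=; apply: eq_bigr => i _; rewrite !coef_poly.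
have iN : (i < N)%N by apply: leq_ltn_trans nN; rewrite -ltnS.
by rewrite iN (leq_ltn_trans (leq_subr i n) nN).
Qed.

Lemma fps_mulC (R : comNzRingType) : commutative (@fps_mul R).
Proof.
move=> f g; apply/fpsP => n.
by rewrite !(fps_coef_mul_trunc _ _ (ltnSn n)) mulrC.
Qed.

Lemma fps_mulA (R : comNzRingType) : associative (@fps_mul R).
Proof.
have key (f g h : fps R) n : fps_coef (fps_mul (fps_mul f g) h) n
    = (fps_trunc n.+1 f * fps_trunc n.+1 g * fps_trunc n.+1 h)`_n.
  rewrite [RHS]coefM /=; apply: eq_bigr => i _; congr (_ * _).
    exact: (fps_coef_mul_trunc _ _ (ltn_ord i)).
  by rewrite coef_poly ltnS leq_subr.
move=> f g h; apply/fpsP => n.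
by rewrite fps_mulC !key; congr (polyseq _)`_n; rewrite mulrC mulrA.
Qed.

Lemma fps_mul1 (R : comNzRingType) : left_id (fps_one R) (@fps_mul R).
Proof.
move=> f; apply/fpsP => n /=.
by rewrite big_ord_recl /= mul1r subn0 big1 ?addr0 // => i _; rewrite mul0r.
Qed.

Lemma fps_mulDl (R : comNzRingType) :
  left_distributive (@fps_mul R) (@fps_add R).
Proof.
move=> f g h; apply/fpsP => n /=.
by rewrite -big_split; apply: eq_bigr => i _; rewrite mulrDl.
Qed.

Lemma fps_one_neq0 (R : comNzRingType) : fps_one R != 0.
Proof. by apply/eqP => /fpsP /(_ 0%N) /= /eqP; rewrite oner_eq0. Qed.

HB.instance Definition _ (R : comNzRingType) :=
  GRing.Zmodule_isComNzRing.Build (fps R)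
    (@fps_mulA R) (@fps_mulC R) (@fps_mul1 R) (@fps_mulDl R) (@fps_one_neq0 R).

Definition fpsX (R : comNzRingType) : fps R := Fps (fun n => (n == 1%N)%:R).

(* A hyphen-free generalized pattern: the set of letters of t is exactly
   {1, ..., m} for some m. *)
Definition gen_pattern (t : seq nat) : Prop := exists m : nat, t =i iota 1 m.

Definition order_iso (u v : seq nat) : bool :=
  (size u == size v) &&
  [forall i : 'I_(size u), forall j : 'I_(size u),
     ((nth 0 u i < nth 0 u j) == (nth 0 v i < nth 0 v j)) &&
     ((nth 0 u i == nth 0 u j) == (nth 0 v i == nth 0 v j))]%N.

(* No occurrence overhangs the end of w: then the factor is too short. *)
Definition occurs_at (t w : seq nat) (p : nat) : bool :=
  order_iso (take (size t) (drop p w)) t.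

Definition contains (t w : seq nat) : bool :=
  [exists p : 'I_(size w).+1, occurs_at t w p].

Definition mcontains (s : nat) (tau : 'I_s -> seq nat) (w : seq nat) : bool :=
  [exists p : {ffun 'I_s -> 'I_(size w).+1},
     [forall i, occurs_at (tau i) w (p i)] &&
     [forall i : 'I_s, forall j : 'I_s,
        (i < j)%N ==> (p i + size (tau i) <= p j)%N]].

(* Words of [k]^n are n-tuples over 'I_k; the letter i of 'I_k stands for
   i + 1 in {1, ..., k}. *)
Definition word (k n : nat) (w : n.-tuple 'I_k) : seq nat :=
  [seq (nat_of_ord i).+1 | i <- w].

Definition avoid_count (P : pred (seq nat)) (k n : nat) : nat :=
  #|[set w : n.-tuple 'I_k | ~~ P (word w)]|.

Definition avoid_gf (P : pred (seq nat)) (k : nat) : fps int :=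
  Fps (fun n => (avoid_count P k n)%:R).

Definition A_pat (t : seq nat) (k : nat) : fps int := avoid_gf (contains t) k.

Definition A_mpat (s : nat) (tau : 'I_s -> seq nat) (k : nat) : fps int :=
  avoid_gf (mcontains tau) k.

(* Main.v *)
Require Import Defs.
From HB Require Import structures.
From mathcomp Require Import all_boot all_order all_algebra.
From mathcomp Require Import zify.
Local Open Scope ring_scope.

(** A word containing [tau^1-...-tau^s] has a shortest prefix containing
    [tau^1], and what follows this prefix contains [tau^2-...-tau^s].  Hence
    [A_tau = A_(tau^1) + Q * A_(tau^2-...-tau^s)], where [Q] counts the words
    that contain [tau^1] while their longest proper prefix does not.  Appending
    a letter to a word avoiding [tau^1] gives either a word avoiding [tau^1] or
    a word counted by [Q], so [Q = (k x - 1) A_(tau^1) + 1].  The theorem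
    follows by induction on [s], starting from [s = 0], where the multi-pattern
    is contained in every word and both sides vanish. *)

Import GRing.Theory.
Set Implicit Arguments.
Unset Strict Implicit.
Unset Printing Implicit Defensive.

(** * Counting words over a finite alphabet *)

Section WordCount.
Variable k : nat.
Implicit Types P Q : pred (seq nat).

Definition word_count P (n : nat) : nat :=
  (\sum_(w : n.-tuple 'I_k) P (word w))%N.

Lemma size_word n (w : n.-tuple 'I_k) : size (word w) = n.
Proof. by rewrite size_map size_tuple. Qed.

Lemma avoid_countE P n : avoid_count P k n = word_count (fun w => ~~ P w) n.
Proof.
rewrite /avoid_count /word_count -sum1_card big_mkcond /=.
by apply: eq_bigr => w _; rewrite inE; case: (P _).
Qed.

Lemma word_count0 P : word_count P 0 = P [::].
Proof.
rewrite /word_count (eq_bigr (fun=> P [::] : nat)).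
  by rewrite sum_nat_const card_tuple expn0 mul1n.
by move=> w _; rewrite tuple0.
Qed.

Lemma word_countS P n :
  word_count P n.+1 = (\sum_(a < k) word_count (fun w => P (a.+1 :: w)) n)%N.
Proof.
rewrite /word_count pair_big /=.
rewrite (reindex (fun p : 'I_k * n.-tuple 'I_k => [tuple of p.1 :: p.2])) //=.
exists (fun w : n.+1.-tuple 'I_k => (thead w, [tuple of behead w])) => p _.
  by case: p => a w; congr (_, _) => //; apply: val_inj.
by rewrite [RHS]tuple_eta.
Qed.

(** The first [m] and the last [n] letters range independently. In the induction on [m] the first
    letter is absorbed into [P], which is therefore generalized. *)
Lemma word_count_cat P Q m n :
  word_count (fun w => P (take m w) && Q (drop m w)) (m + n) =
  (word_count P m * word_count Q n)%N.
Proof.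
elim: m P => [|m IH] P.
  rewrite add0n word_count0 /word_count big_distrr /=.
  by apply: eq_bigr => w _; rewrite take0 drop0 mulnb.
rewrite addSn !word_countS big_distrl /=; apply: eq_bigr => a _.
exact: (IH (fun w => P (a.+1 :: w))).
Qed.

Lemma word_count_predT1 : word_count xpredT 1 = k.
Proof.
rewrite word_countS (eq_bigr (fun=> 1%N)) ?sum1_card ?card_ord // => a _.
by rewrite word_count0.
Qed.

End WordCount.

(** * Shortest prefixes with a monotone property *)

Definition prefix_monotone (P : pred (seq nat)) : Prop :=
  forall u v, P u -> P (u ++ v).

Definition suffix_monotone (P : pred (seq nat)) : Prop :=
  forall u v, P v -> P (u ++ v).

(* For prefix-monotone [P], no proper prefix of [w] satisfies [P]. *)
Definition minimal_word (P : pred (seq nat)) (w : seq nat) : bool :=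
  P w && ((size w == 0%N) || ~~ P (take (size w).-1 w)).

Section FirstOccurrence.
Variables (k : nat) (P : pred (seq nat)).
Hypothesis monoP : prefix_monotone P.

Lemma prefix_monotone_le i j w : (i <= j)%N -> P (take i w) -> P (take j w).
Proof. by move=> ij Pi; rewrite -(subnKC ij) takeD; apply: monoP. Qed.

Lemma prefix_monotone_take i w : P (take i w) -> P w.
Proof. by rewrite -{2}(cat_take_drop i w); apply: monoP. Qed.

Lemma minimal_word_take n w : size w = n.+1 ->
  (~~ P (take n w) : nat) = (~~ P w + minimal_word P w)%N.
Proof.
move=> sw; rewrite /minimal_word sw /=.
by have := @prefix_monotone_take n w; case: (P w); case: (P (take n w)) => // /(_ isT).
Qed.

(** Both sides count the words of length [n.+1] whose prefix of length [n] avoids [P]; the last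
    letter is free. *)
Lemma minimal_word_countS n :
  (avoid_count P k n * k =
   avoid_count P k n.+1 + word_count k (minimal_word P) n.+1)%N.
Proof.
rewrite !avoid_countE -[X in (_ * X)%N](word_count_predT1 k) -word_count_cat.
rewrite /word_count -big_split /= addn1; apply: eq_bigr => w _.
by rewrite andbT minimal_word_take ?size_word.
Qed.

Lemma minimal_word_gf :
  Fps (fun n => (word_count k (minimal_word P) n)%:R : int) =
  (k%:R * fpsX int - 1) * avoid_gf P k + 1.
Proof.
have -> : (k%:R * fpsX int - 1) * avoid_gf P k + 1 =
          fpsX int * (avoid_gf P k *+ k) - avoid_gf P k + 1.
  by rewrite mulrBl mul1r -mulrA mulr_natl mulrnAr.
have coefMn (f : fps int) j n : fps_coef (f *+ j) n = fps_coef f n *+ j.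
  by elim: j => // j IHj; rewrite !mulrSr /= IHj.
(* The summand [1] corrects the constant term: the empty word is minimal exactly when it satisfies
   [P]. *)
apply/fpsP => -[|n] /=.
  rewrite big_ord1 mul0r add0r avoid_countE !word_count0 /minimal_word /=.
  by case: (P [::]).
rewrite !big_ord_recl /= mul0r add0r subSS subn0 mul1r big1 => [|i _].
  rewrite addr0 coefMn /= addr0 -mulrnA minimal_word_countS natrD.
  by rewrite addrAC subrr add0r.
by rewrite mul0r.
Qed.

Variables R C : pred (seq nat).
Hypothesis monoR : suffix_monotone R.
Hypothesis splitC :
  forall w, reflect (exists i, P (take i w) && R (drop i w)) (C w).

(** At most one summand is nonzero, since a word satisfying [P] has exactly one minimal prefix. *)
Lemma avoid_split n w : size w = n ->
  (~~ C w : nat) =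
  (~~ P w + \sum_(i < n.+1) (minimal_word P (take i w) && ~~ R (drop i w)))%N.
Proof.
move=> sw; case: (boolP (P w)) => Pw /=; last first.
  rewrite big1 => [|i _].
    by case: splitC => //
      -[i /andP[/prefix_monotone_take]]; rewrite (negPf Pw).
  have /negPf nPi : ~~ P (take i w).
    by apply: contra Pw; apply: prefix_monotone_take.
  by rewrite /minimal_word nPi.
have exP : exists i, P (take i w) by exists n; rewrite -sw take_size.
case: (ex_minnP exP) => m Pm min_m.
have lt_mn : (m < n.+1)%N by rewrite ltnS min_m // -sw take_size.
have minE (i : 'I_n.+1) : minimal_word P (take i w) = (i == m :> nat).
  have lt_in := ltn_ord i.
  have si : size (take i w) = i by rewrite size_takel // sw -ltnS.
  rewrite /minimal_word si take_takel ?leq_pred //.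
  apply/andP/eqP => [[Pi /orP[/eqP i0|nPi]]|->].
  - by have := min_m _ Pi; lia.
  - have := min_m _ Pi; rewrite leq_eqVlt => /predU1P[//|lt_mi].
    by case/negP: nPi; apply: prefix_monotone_le Pm; lia.
  - split=> //; case: (posnP m) => //= m_gt0.
    by apply/negP => /min_m; lia.
rewrite (bigD1 (Ordinal lt_mn)) //= big1 => [|i].
  have -> : minimal_word P (take m w) by rewrite (minE (Ordinal lt_mn)) /=.
  rewrite addn0 /=; congr (nat_of_bool (~~ _)).
  (* Any valid cut [i] can be moved back to the earliest one: [m <= i], so [drop i w] is a suffix of
     [drop m w]. *)
  apply/splitC/idP => [[i /andP[Pi Ri]]|Rm]; last by exists m; rewrite Pm.
  rewrite -(cat_take_drop (i - m) (drop m w)); apply: monoR.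
  by rewrite drop_drop subnK ?min_m.
by rewrite minE -val_eqE /= => /negPf->.
Qed.

Lemma avoid_gf_split :
  avoid_gf C k =
  avoid_gf P k + ((k%:R * fpsX int - 1) * avoid_gf P k + 1) * avoid_gf R k.
Proof.
rewrite -minimal_word_gf; apply/fpsP => n /=.
(* Each term of the Cauchy product counts words of length [n] cut at [i]. *)
rewrite [in RHS](eq_bigr (fun i : 'I_n.+1 => (word_count k
  (fun w => minimal_word P (take i w) && ~~ R (drop i w)) n)%:R)) => [|i _].
  rewrite -natr_sum -natrD !avoid_countE; congr (_%:R).
  rewrite /word_count exchange_big -big_split /=.
  by apply: eq_bigr => w _; rewrite (@avoid_split n) ?size_word.
have le_in : (i <= n)%N by rewrite -ltnS.
by rewrite avoid_countE -natrM -word_count_cat subnKC.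
Qed.

End FirstOccurrence.

(** * Occurrences of patterns and cuts of a word *)

Lemma containsP t w :
  reflect (exists p, (p <= size w)%N && occurs_at t w p) (contains t w).
Proof.
apply: (iffP existsP) => [[p tp]|[p /andP[le_p tp]]].
  by exists p; rewrite -ltnS ltn_ord.
by exists (Ordinal (le_p : (p < (size w).+1)%N)).
Qed.

Lemma mcontainsP s (tau : 'I_s -> seq nat) w :
  reflect (exists p : 'I_s -> nat,
             [/\ forall i, (p i <= size w)%N,
                 forall i, occurs_at (tau i) w (p i) &
                 forall i j : 'I_s, (i < j)%N ->
                   (p i + size (tau i) <= p j)%N])
          (mcontains tau w).
Proof.
apply: (iffP existsP) => [[p /andP[/forallP tp /forallP ltp]]|[p [lep tp ltp]]].
  exists (fun i => p i : nat); split=> // [i|i j ij]; first by rewrite -ltnS.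
  by have /forallP/(_ j)/implyP := ltp i; apply.
exists [ffun i => inord (p i)]; apply/andP; split; apply/forallP => i.
  by rewrite ffunE inordK ?ltnS.
apply/forallP => j; apply/implyP => ij.
by rewrite !ffunE !inordK ?ltnS // ltp.
Qed.

(** [order_iso] forces the factor to have full length. The bound on [p] matters for empty [t], which
    occurs even beyond the end of [w]. *)
Lemma occurs_at_size t w p :
  (p <= size w)%N -> occurs_at t w p -> (p + size t <= size w)%N.
Proof. by move=> le_p /andP[/eqP + _]; rewrite size_take_min size_drop; lia. Qed.

Lemma occurs_at_take t w p i : (p + size t <= i)%N ->
  occurs_at t (take i w) p = occurs_at t w p.
Proof.
by move=> le_i; rewrite /occurs_at !take_drop take_takel // addnC.
Qed.

Lemma occurs_at_drop t w p i : occurs_at t (drop i w) p = occurs_at t w (p + i).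
Proof. by rewrite /occurs_at drop_drop. Qed.

Lemma contains_prefix_monotone t : prefix_monotone (contains t).
Proof.
move=> u v /containsP[p /andP[le_p tp]]; apply/containsP; exists p.
rewrite size_cat (leq_trans le_p) ?leq_addr //=.
by rewrite -(@occurs_at_take _ _ _ (size u)) ?take_size_cat ?occurs_at_size.
Qed.

Lemma mcontains_suffix_monotone s (tau : 'I_s -> seq nat) :
  suffix_monotone (mcontains tau).
Proof.
move=> u v /mcontainsP[p [le_p tp lt_p]]; apply/mcontainsP.
exists (fun i => p i + size u)%N; split=> [i|i|i j ij].
- by rewrite size_cat addnC leq_add2l.
- by rewrite -occurs_at_drop drop_size_cat.
- by rewrite addnAC leq_add2r lt_p.
Qed.

Lemma mcontains0 (tau : 'I_0 -> seq nat) w : mcontains tau w.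
Proof. by apply/mcontainsP; exists (fun=> 0%N); split=> [] []. Qed.

(** The cut is placed where the occurrence of the first block ends; conversely, occurrences on the
    two sides of a cut cannot overlap. *)
Lemma mcontainsSP s (tau : 'I_s.+1 -> seq nat) w :
  reflect (exists i, contains (tau ord0) (take i w) &&
             mcontains (fun j => tau (lift ord0 j)) (drop i w))
          (mcontains tau w).
Proof.
apply: (iffP idP) => [/mcontainsP[p [le_p tp lt_p]]|].
  have le_e := occurs_at_size (le_p ord0) (tp ord0).
  exists (p ord0 + size (tau ord0))%N; apply/andP; split.
    apply/containsP; exists (p ord0).
    by rewrite occurs_at_take // tp size_takel // leq_addr.
  apply/mcontainsP.
  exists (fun j => p (lift ord0 j) - (p ord0 + size (tau ord0)))%N.
  split=> [j|j|j l jl].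
  - by rewrite size_drop leq_sub2r.
  - by rewrite occurs_at_drop subnK ?lt_p.
  - have := lt_p (lift ord0 j) (lift ord0 l) jl.
    by have := lt_p ord0 (lift ord0 j) isT; lia.
case=> i /andP[/containsP[p0 /andP[le_p0 tp0]] /mcontainsP[p [le_p tp lt_p]]].
have le_e := occurs_at_size le_p0 tp0.
(* Later blocks are shifted by the true length of [take i w], as [i] may exceed [size w]. *)
pose q (j : 'I_s.+1) := if unlift ord0 j is Some l then (p l + minn i (size w))%N
                        else p0.
have q0 : q ord0 = p0 by rewrite /q unlift_none.
have qS l : q (lift ord0 l) = (p l + minn i (size w))%N by rewrite /q liftK.
have drop_minn : drop i w = drop (minn i (size w)) w.
  by have [//|lt_wi] := leqP i (size w); rewrite drop_size drop_oversize // ltnW.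
rewrite size_take_min in le_p0 le_e.
apply/mcontainsP; exists q; split=> [j|j|j l].
- case: (unliftP ord0 j) => [l ->|->]; rewrite ?q0 ?qS; last by lia.
  by have := le_p l; rewrite size_drop; lia.
- case: (unliftP ord0 j) => [l ->|->]; rewrite ?q0 ?qS.
    by rewrite -occurs_at_drop -drop_minn.
  by rewrite -(@occurs_at_take _ _ _ i) //; lia.
- case: (unliftP ord0 l) => [l' ->|-> //]; rewrite qS.
  case: (unliftP ord0 j) => [j' ->|-> _]; rewrite ?q0 ?qS; last by lia.
  by rewrite !lift0 ltnS => /lt_p; lia.
Qed.

(** * Recursion on the number of blocks *)

Lemma A_mpat_rec s (tau : 'I_s.+1 -> seq nat) k :
  A_mpat tau k = A_pat (tau ord0) k +
    ((k%:R * fpsX int - 1) * A_pat (tau ord0) k + 1) *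
    A_mpat (fun j => tau (lift ord0 j)) k.
Proof.
apply: avoid_gf_split; first exact: contains_prefix_monotone.
  exact: mcontains_suffix_monotone.
exact: mcontainsSP.
Qed.

Lemma A_mpatE s (tau : 'I_s -> seq nat) k :
  A_mpat tau k =
    \sum_(j < s) A_pat (tau j) k *
      \prod_(i < s | (i < j)%N) ((k%:R * fpsX int - 1) * A_pat (tau i) k + 1).
Proof.
elim: s tau => [|s IH] tau.
  rewrite big_ord0; apply/fpsP => n /=; rewrite avoid_countE.
  by rewrite /word_count big1 // => w _; rewrite mcontains0.
rewrite A_mpat_rec IH big_ord_recl; congr (_ + _).
  by rewrite big_pred0 ?mulr1.
rewrite big_distrr /=; apply: eq_bigr => j _.
(* The factor of block [0] lies in the product for every later [j]; it is the one supplied by the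
   recursion. *)
by rewrite mulrCA [in RHS]big_mkcond big_ord_recl /= -big_mkcond.
Qed.

Theorem mainTheorem12 (s : nat) (tau : 'I_s -> seq nat) (k : nat)
    (hs : (0 < s)%N)
    (htau : forall i : 'I_s, gen_pattern (tau i) /\ tau i <> [::])
    (hk : (1 <= k)%N) :
  A_mpat tau k =
    \sum_(j < s) A_pat (tau j) k *
      \prod_(i < s | (i < j)%N) ((k%:R * fpsX int - 1) * A_pat (tau i) k + 1).
Proof. exact: A_mpatE. Qed.
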